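(* Let $\mathcal{P}$ be the set of primitive Pythagorean triples $(x,y,a)$ with $x$ odd and $y$ even, and let $\mathcal{D}$ be the set of all pairs of arithmetic progressions, each recorded as (first term, common difference, number of terms), that correspond to the connected gnomons of triples in $\mathcal{P}$. Then the map $$\mathcal{P}\to\mathcal{D},\qquad (x,y,a)\mapsto \bigl((2x+1,\,2,\,T_y),\;(2y+1,\,2,\,T_x)\bigr),\qquad T_y=a-x,\quad T_x=a-y,$$ is a bijection.
   Context: A primitive Pythagorean triple is a triple $(x,y,a)$ of positive integers with $x^2+y^2=a^2$ and $\gcd(x,y,a)=1$; $x$ denotes the odd leg and $y$ the even leg. For integers $0<s<a$, the gnomon with inner side $s$ and outer side $a$ is the L-shaped figure which, added to a square of side $s$, completes it to a square of side $a$; its thickness is $a-s$. It is the union of $a-s$ consecutive gnomons of thickness $1$, with areas $2s+1,2s+3,\dots,2a-1$; this arithmetic progression (first term $2s+1$, difference $2$, $a-s$ terms) is the one corresponding to the gnomon. The connected gnomons of the triple $(x,y,a)$ are $G_y$ (inner side $x$, outer side $a$) and $G_x$ (inner side $y$, outer side $a$). *)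

(* Defs.v *)
From mathcomp Require Import all_boot.
From mathcomp Require Import classical_sets functions.
Set Implicit Arguments.
Unset Strict Implicit.
Unset Printing Implicit Defensive.

Local Open Scope nat_scope.
Local Open Scope classical_set_scope.

(* A triple [(x, y, a)] has odd leg [x], even leg [y] and hypotenuse [a]. *)
Definition primitive_triples : set (nat * nat * nat) :=
  [set t | let: (x, y, a) := t in
     [/\ 0 < x, 0 < y & 0 < a] /\
     [/\ x ^ 2 + y ^ 2 = a ^ 2, gcdn x (gcdn y a) = 1, odd x & ~~ odd y]].

(* An arithmetic progression is recorded as
   (first term, common difference, number of terms). *)
Definition progression := (nat * nat * nat)%type.

Definition first_term (p : progression) := p.1.1.
Definition common_difference (p : progression) := p.1.2.
Definition number_of_terms (p : progression) := p.2.
Definition term (p : progression) (i : nat) :=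
  first_term p + i * common_difference p.

(* An L-shaped figure; the condition [0 < inner < outer] is [is_gnomon]. *)
Record gnomon := Gnomon { inner : nat; outer : nat }.

Definition is_gnomon (g : gnomon) := 0 < inner g < outer g.
Definition thickness (g : gnomon) := outer g - inner g.
Definition area (g : gnomon) := outer g ^ 2 - inner g ^ 2.

(* [g] is the union of its layers of thickness 1 of indices
   [0, ..., thickness g - 1], counted from the inner side. *)
Definition layer (g : gnomon) (i : nat) : gnomon :=
  Gnomon (inner g + i) (inner g + i).+1.

(* The common difference has to be prescribed: when [thickness g = 1], the
   areas of the layers do not determine it. *)
Definition corresponds (g : gnomon) (p : progression) : Prop :=
  [/\ is_gnomon g,
      common_difference p = 2,
      number_of_terms p = thickness g &
      forall i, i < thickness g -> term p i = area (layer g i)].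

Definition G_y (t : nat * nat * nat) : gnomon :=
  let: (x, y, a) := t in Gnomon x a.
Definition G_x (t : nat * nat * nat) : gnomon :=
  let: (x, y, a) := t in Gnomon y a.

(* Ordered pairs: the progression of [G_y] comes first. *)
Definition connected_gnomon_progressions : set (progression * progression) :=
  [set pq | exists2 t, primitive_triples t &
     corresponds (G_y t) pq.1 /\ corresponds (G_x t) pq.2].

(* Main.v *)
Require Import Defs.
From mathcomp Require Import all_boot.
From mathcomp Require Import classical_sets functions.
From mathcomp Require Import zify.

(** A gnomon and its progression determine each other: layer [i] over inner side [s] has area
    [(s + i + 1)^2 - s_i^2 = 2 (s + i) + 1] with [s_i = s + i], so [(2 s + 1, 2, a - s)] is the only
    progression for sides [s < a] ([corresponds_iff]). As both legs are shorter than the hypotenuse,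
    the map lands in the target and is onto; it is injective because the first terms give back [x]
    and [y], and [a = x + T_y]. *)

Lemma area_layer (g : gnomon) (i : nat) :
  area (layer g i) = 2 * (inner g + i) + 1.
Proof.
by rewrite /area /= subn_sqr subSnn mul1n addSn addn1 mul2n -addnn.
Qed.

Lemma corresponds_iff (s a : nat) (p : progression) :
  corresponds (Gnomon s a) p <-> 0 < s < a /\ p = (2 * s + 1, 2, a - s).
Proof.
split=> [|[sa ->]].
  case: p => -[f d] n []; rewrite /is_gnomon /thickness /= => sa dE nE termE.
  (* Thickness is positive, so layer 0 exists and its area fixes the first term; the other two
     entries are prescribed. *)
  split=> //; have /termE : 0 < a - s by lia.
  rewrite area_layer /term /first_term /= mul0n !addn0 => ->.
  by move: dE nE; rewrite /common_difference /number_of_terms /= => -> ->.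
split=> // i _.
rewrite area_layer /term /first_term /common_difference /=; lia.
Qed.

Lemma leg_lt_hypotenuse (x y a : nat) :
  0 < y -> x ^ 2 + y ^ 2 = a ^ 2 -> x < a.
Proof.
by move=> y_gt0 xya; rewrite -ltn_sqr -xya -[ltnLHS]addn0 ltn_add2l expn_gt0 y_gt0.
Qed.

Theorem theorem2p2 :
  set_bij primitive_triples connected_gnomon_progressions
    (fun '(x, y, a) => let T_y := a - x in let T_x := a - y in
       ((2 * x + 1, 2, T_y), (2 * y + 1, 2, T_x))).
Proof.
have legs_lt x y a : primitive_triples (x, y, a) -> 0 < x < a /\ 0 < y < a.
  move=> [[x0 y0 _] [xya _ _ _]]; rewrite x0 y0 (leg_lt_hypotenuse _ _ _ y0 xya).
  by split=> //; apply: (leg_lt_hypotenuse _ x); rewrite // addnC.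
split=> [[[x y] a] Pt|[[x y] a] [[x' y'] a'] /set_mem Pt /set_mem Pt' /=|[p q]].
- have [xa ya] := legs_lt _ _ _ Pt.
  by exists (x, y, a) => //; split; apply/corresponds_iff.
- have [xa _] := legs_lt _ _ _ Pt; have [xa' _] := legs_lt _ _ _ Pt'.
  (* Subtraction on [nat] truncates, so recovering [a] from [a - x] relies on [x < a] and
     [x' < a']. *)
  move=> [x_eq Ty_eq y_eq _]; congr (_, _, _); lia.
- move=> [[[x y] a] Pt [/corresponds_iff[_ /= pE] /corresponds_iff[_ /= qE]]].
  by exists (x, y, a) => //; rewrite pE qE.
Qed.
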